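(* Let $R$ be a ring, let $\mathcal{X}$ be a non-empty class of right $R$-modules closed under isomorphisms, and let $M$ be a right $R$-module with a monomorphic $\mathcal{X}$-envelope $u:M\to X$ such that $\mathrm{End}(X)/J(\mathrm{End}(X))$ is a von Neumann regular right self-injective ring and idempotents lift modulo $J(\mathrm{End}(X))$. If $M$ is $\mathcal{X}$-automorphism-invariant, then $M$ satisfies the finite exchange property.
   Context: Rings are associative with identity, modules are unital right modules, $J(-)$ is the Jacobson radical. An $\mathcal{X}$-preenvelope of $M$ is a homomorphism $u:M\to X$ with $X\in\mathcal{X}$ such that every homomorphism $M\to X'$ with $X'\in\mathcal{X}$ factors through $u$. It is an $\mathcal{X}$-envelope if, moreover, every endomorphism $h$ of $X$ with $h\circ u=u$ is an automorphism; it is monomorphic if $u$ is a monomorphism. $M$ is $\mathcal{X}$-automorphism-invariant if there is an $\mathcal{X}$-envelope $u:M\to X$ such that for every automorphism $g$ of $X$ there is an endomorphism $f$ of $M$ with $u\circ f=g\circ u$. A right $R$-module $M$ has the (full) exchange property if for every right $R$-module $A$ and any two direct sum decompositions $A=M'\oplus N=\bigoplus_{i\in I}A_i$ with $M'\cong M$ there are submodules $B_i\subseteq A_i$ with $A=M'\oplus\bigl(\bigoplus_{i\in I}B_i\bigr)$; it has the finite exchange property if this holds for all finite index sets $I$. *)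

(* Defs.v *)
From HB Require Import structures.
From mathcomp Require Import all_boot all_algebra.
From mathcomp Require Import boolp classical_sets.

Set Implicit Arguments.
Unset Strict Implicit.
Unset Printing Implicit Defensive.

Import GRing.Theory.
Local Open Scope ring_scope.
Local Open Scope classical_set_scope.
Local Open Scope quotient_scope.

(* A right R-module is a left module over the converse ring R^c.  Rings are
   pzRingTypes, so that the zero ring (e.g. End(0)) is not excluded. *)
Notation rmodType R := (lmodType R^c).

(* S as a right module over itself: in S^c^o, a *: x is the product x * a
   of S. *)
Notation regular_rmod S := (S^c^o : rmodType S).

(* Endomorphisms act on the left of right modules: f * g is f \o g. *)
Definition Endo (R : pzRingType) (V : lmodType R) : Type := {linear V -> V}.

Section EndoRing.
Variables (R : pzRingType) (V : lmodType R).
Implicit Types f g h : Endo V.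

HB.instance Definition _ := gen_eqMixin (Endo V).
HB.instance Definition _ := gen_choiceMixin (Endo V).

Lemma endoP f g : (forall x, f x = g x) -> f = g.
Proof.
case: f => f cf; case: g => g cg /= /funext fg.
move: cf; rewrite {}fg => cf; congr GRing.Linear.Pack.
case: cf cg => [[f1] [f2]] [[g1] [g2]].
by rewrite (Prop_irrelevance f1 g1) (Prop_irrelevance f2 g2).
Qed.

Definition endo0 : Endo V := \0 : {linear V -> V}.
Definition endo1 : Endo V := idfun : {linear V -> V}.
Definition endoD f g : Endo V := f \+ g : {linear V -> V}.
Definition endoN f : Endo V := \- f : {linear V -> V}.
Definition endoM f g : Endo V := f \o g : {linear V -> V}.

Fact endoDA : associative endoD.
Proof. by move=> f g h; apply: endoP => x /=; rewrite addrA. Qed.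
Fact endoDC : commutative endoD.
Proof. by move=> f g; apply: endoP => x /=; rewrite addrC. Qed.
Fact endo0D : left_id endo0 endoD.
Proof. by move=> f; apply: endoP => x /=; rewrite add0r. Qed.
Fact endoND : left_inverse endo0 endoN endoD.
Proof. by move=> f; apply: endoP => x /=; rewrite addNr. Qed.
HB.instance Definition _ :=
  GRing.isZmodule.Build (Endo V) endoDA endoDC endo0D endoND.

Fact endoMA : associative endoM.
Proof. by move=> f g h; apply: endoP. Qed.
Fact endo1M : left_id endo1 endoM.
Proof. by move=> f; apply: endoP. Qed.
Fact endoM1 : right_id endo1 endoM.
Proof. by move=> f; apply: endoP. Qed.
Fact endoMDl : left_distributive endoM +%R.
Proof. by move=> f g h; apply: endoP. Qed.
Fact endoMDr : right_distributive endoM +%R.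
Proof. by move=> f g h; apply: endoP => x /=; rewrite raddfD. Qed.
HB.instance Definition _ := GRing.Zmodule_isPzRing.Build (Endo V)
  endoMA endo1M endoM1 endoMDl endoMDr.

End EndoRing.

Definition submodule (R : pzRingType) (V : lmodType R) (A : set V) : Prop :=
  submod_closed (mem A).

Definition right_ideal (S : pzRingType) (I : set S) : Prop :=
  @submodule S^c (regular_rmod S) I.

Definition maximal_right_ideal (S : pzRingType) (m : set S) : Prop :=
  [/\ right_ideal m, m <> setT &
      forall I : set S, right_ideal I -> m `<=` I -> I = m \/ I = setT].

Definition jacobson (S : pzRingType) : {pred S} :=
  fun x => `[< forall m : set S, maximal_right_ideal m -> m x >].
Arguments jacobson : clear implicits.

Section Jacobson.
Variable S : pzRingType.
Implicit Types (I m : set S) (x y a : S).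

Lemma right_idealP I : right_ideal I <->
  I 0 /\ forall a x y, I x -> I y -> I (x * a + y).
Proof.
split=> [[I0 IL]|[I0 IL]].
  split=> [|a x y Ix Iy]; first exact: set_mem I0.
  by apply: set_mem; apply: (IL a x y); apply: mem_set.
split; first exact: mem_set.
by move=> a x y /set_mem Ix /set_mem Iy; apply: mem_set; apply: IL.
Qed.

Fact jacobson_zmod_closed : zmod_closed (jacobson S).
Proof.
split=> [|x y /asboolP Jx /asboolP Jy]; apply/asboolP => m mm; have [mI _ _] := mm;
  have [m0 mL] := (right_idealP m).1 mI; first by [].
by rewrite addrC -mulrN1; apply: mL; [apply: Jy|apply: Jx].
Qed.

HB.instance Definition _ :=
  GRing.isZmodClosed.Build S (jacobson S) jacobson_zmod_closed.

Lemma jacobsonMr a x : x \in jacobson S -> x * a \in jacobson S.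
Proof.
move=> /asboolP Jx; apply/asboolP => m mm; have [mI _ _] := mm.
have [m0 mL] := (right_idealP m).1 mI.
by rewrite -[_ * _]addr0; apply: mL => //; apply: Jx.
Qed.

Lemma jacobsonMl a x : x \in jacobson S -> a * x \in jacobson S.
Proof.
move=> /asboolP Jx; apply/asboolP => m mm; have [mI mT mmax] := mm.
have [m0 mL] := (right_idealP m).1 mI.
have mM y b : m y -> m (y * b) by move=> my; rewrite -[_ * _]addr0; apply: mL.
have [ma|nma] := pselect (m a); first exact: mM.
pose n : set S := [set y | m (a * y)].
suff: maximal_right_ideal n by move/Jx.
split.
- apply/right_idealP; split; first by rewrite /n /= mulr0.
  by move=> b y z ny nz; rewrite /n /= mulrDr mulrA; apply: mL.
- by move=> nT; apply: nma; have : n 1 by [rewrite nT]; rewrite /n /= mulr1.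
move=> I II nI; have [I0 IL] := (right_idealP I).1 II.
have [In|] := pselect (I `<=` n); first by left; apply/seteqP.
move=> /existsNP[t /not_implyP[It nt]]; right.
pose k : set S := [set y | exists2 q, m (y - a * t * q) & True].
have kI : right_ideal k.
  apply/right_idealP; split; first by exists 0; rewrite // mulr0 subr0.
  move=> b y z [q mq _] [q' mq' _]; exists (q * b + q') => //.
  rewrite mulrDr !mulrA opprD addrACA -mulrBl; exact: mL.
have mk : m `<=` k by move=> y my; exists 0; rewrite // mulr0 subr0.
have [km|kT] := mmax k kI mk.
  by case: nt; rewrite /n /= -km; exists 1; rewrite // mulr1 subrr.
have [q mq _] : k a by rewrite kT.
have I1 : I 1.
  rewrite -[1](subrK (t * q)) addrC; apply: IL => //; apply: nI.
  by rewrite /n /= mulrBr mulr1 mulrA.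
apply/seteqP; split=> // y _; rewrite -[y]mul1r -[_ * _]addr0.
exact: IL.
Qed.

End Jacobson.

Definition jacobson_quot (S : pzRingType) : Type :=
  Quotient.quot (jacobson S).

Section JacobsonQuotient.
Variable S : pzRingType.
Local Notation Q := (jacobson_quot S).

HB.instance Definition _ := GRing.Zmodule.on Q.
HB.instance Definition _ := ZmodQuotient.on Q.

Definition jquot1 : Q := lift_cst Q 1.
Definition jquotM : Q -> Q -> Q := lift_op2 Q *%R.

Lemma jquot_eqP (x y : S) : reflect (\pi_Q x = \pi_Q y) (x - y \in jacobson S).
Proof. by rewrite Quotient.idealrBE; apply: eqP. Qed.

Lemma jquot_piM (x y : S) : jquotM (\pi_Q x) (\pi_Q y) = \pi_Q (x * y).
Proof.
unlock jquotM; apply/jquot_eqP; set x' := repr _; set y' := repr _.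
have Jx : x' - x \in jacobson S by apply/jquot_eqP; rewrite reprK.
have Jy : y' - y \in jacobson S by apply/jquot_eqP; rewrite reprK.
have -> : x' * y' - x * y = (x' - x) * y' + x * (y' - y).
  by rewrite mulrBl mulrBr addrA subrK.
by apply: rpredD; [apply: jacobsonMr|apply: jacobsonMl].
Qed.

Lemma jquot_piD (x y : S) : \pi_Q x + \pi_Q y = \pi_Q (x + y).
Proof. exact: (esym (Quotient.pi_add (jacobson S) x y)). Qed.

Fact jquotMA : associative jquotM.
Proof.
by move=> x y z; rewrite -[x]reprK -[y]reprK -[z]reprK !jquot_piM mulrA.
Qed.
Fact jquot1M : left_id jquot1 jquotM.
Proof. by move=> x; unlock jquot1; rewrite -[x]reprK jquot_piM mul1r. Qed.
Fact jquotM1 : right_id jquot1 jquotM.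
Proof. by move=> x; unlock jquot1; rewrite -[x]reprK jquot_piM mulr1. Qed.
Fact jquotMDl : left_distributive jquotM +%R.
Proof.
move=> x y z; rewrite -[x]reprK -[y]reprK -[z]reprK.
by rewrite jquot_piD !jquot_piM jquot_piD mulrDl.
Qed.
Fact jquotMDr : right_distributive jquotM +%R.
Proof.
move=> x y z; rewrite -[x]reprK -[y]reprK -[z]reprK.
by rewrite jquot_piD !jquot_piM jquot_piD mulrDr.
Qed.
HB.instance Definition _ := GRing.Zmodule_isPzRing.Build Q
  jquotMA jquot1M jquotM1 jquotMDl jquotMDr.

End JacobsonQuotient.

Definition von_neumann_regular (S : pzRingType) : Prop :=
  forall a : S, exists x : S, a * x * a = a.

Definition injective_module (R : pzRingType) (E : lmodType R) : Prop :=
  forall (A B : lmodType R) (i : {linear A -> B}) (f : {linear A -> E}),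
    injective i -> exists g : {linear B -> E}, forall x, g (i x) = f x.

Definition right_self_injective (S : pzRingType) : Prop :=
  injective_module (regular_rmod S).

Definition idempotents_lift (S : pzRingType) (I : {pred S}) : Prop :=
  forall e : S, e * e - e \in I -> exists2 f : S, f * f = f & f - e \in I.

Section Envelopes.
Variables (R : pzRingType) (XX : rmodType R -> Prop).

Definition iso_closed : Prop :=
  forall (X Y : rmodType R) (f : {linear X -> Y}), bijective f -> XX X -> XX Y.

Definition preenvelope (M X : rmodType R) (u : {linear M -> X}) : Prop :=
  XX X /\
  forall (X' : rmodType R) (h : {linear M -> X'}), XX X' ->
    exists g : {linear X -> X'}, forall x, g (u x) = h x.

Definition envelope (M X : rmodType R) (u : {linear M -> X}) : Prop :=
  preenvelope u /\
  forall h : {linear X -> X}, (forall x, h (u x) = u x) -> bijective h.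

Definition automorphism_invariant (M : rmodType R) : Prop :=
  exists (X : rmodType R) (u : {linear M -> X}),
    envelope u /\
    forall g : {linear X -> X}, bijective g ->
      exists f : {linear M -> M}, forall x, u (f x) = g (u x).

End Envelopes.

(* A is the internal direct sum of the submodules C i, for i in I. *)
Definition direct_sum (R : pzRingType) (A : lmodType R) (I : finType)
    (C : I -> set A) : Prop :=
  (forall i, submodule (C i)) /\
  forall a : A, exists! c : {ffun I -> A},
    (forall i, C i (c i)) /\ a = \sum_i c i.

(* M' (+) N is indexed by bool, and M' (+) ((+)_i B i) by option I, M' being
   the summand at None.  The linear map j is an isomorphism of M onto M'. *)
Definition finite_exchange (R : pzRingType) (M : rmodType R) : Prop :=
  forall (A : rmodType R) (M' N : set A) (I : finType) (C : I -> set A),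
    direct_sum (fun b : bool => if b then M' else N) ->
    direct_sum C ->
    (exists2 j : {linear M -> A}, injective j & range j = M') ->
    exists B : I -> set A,
      (forall i, submodule (B i) /\ B i `<=` C i) /\
      direct_sum (oapp B M').

(* Main.v *)
Require Import Defs.
From HB Require Import structures.
From mathcomp Require Import all_boot all_algebra.
From mathcomp Require Import boolp classical_sets.
Local Open Scope ring_scope.

(** Let S = End(X) and Q = S/J(S).  The endomorphisms of X that map M into
    itself form a subring E of S.  Since automorphisms of X restrict to M, E
    contains the units of S, hence also J(S), and its image T in Q contains the
    units of Q.

    T is von Neumann regular.  Take a maximal partial homomorphism between right
    ideals of Q whose domain meets its range trivially (in the sense of
    [disjoint_graph]).  By self-injectivity it yields orthogonal isomorphic
    idempotents f, g such that h = 1 - f - g has an abelian corner hQh.  Elements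
    z with z^2 = 0 lie in T, because 1 + z is a unit, and this forces the ideals
    generated by f and g into T.  So modulo these ideals T is determined by its
    elements in hQh, where each s has a group inverse s'; the element
    (f + g) + s + (h - s s') is a unit of Q, so its inverse is in T, and hence
    so is s'.

    Regularity of T and the lifting of idempotents give, for each a in E, an
    idempotent e in E a with 1 - e in E (1 - a).  This property descends to
    End(M), which is a quotient of E, and implies finite exchange: write
    1 as a sum of orthogonal idempotents e_i = x_i (v p_i j), where j embeds M as
    M', v projects onto M' and p_i onto the i-th summand; then the summand B_i
    is the kernel of e_i x_i v on C_i. *)

Set Implicit Arguments.
Unset Strict Implicit.
Unset Printing Implicit Defensive.
Import GRing.Theory.
Local Open Scope classical_set_scope.
Local Open Scope quotient_scope.

(** * Submodules as modules, and partial endomorphisms of a self-injective ring *)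

(* The proof HA is a phantom argument: it lets the closure properties be
   inferred from the predicate. *)
Definition submodule_pred (R : pzRingType) (V : lmodType R) (A : set V)
  (HA : submodule A) : {pred V} := mem A.

Section SubmoduleType.
Variables (R : pzRingType) (V : lmodType R) (A : set V) (HA : submodule A).

Fact submodule_pred_closed : submod_closed (submodule_pred HA).
Proof. exact: HA. Qed.
HB.instance Definition _ :=
  GRing.isSubmodClosed.Build R V (submodule_pred HA) submodule_pred_closed.

Definition submodule_type : Type := {x : V | x \in submodule_pred HA}.
HB.instance Definition _ := SubType.on submodule_type.
HB.instance Definition _ := [Choice of submodule_type by <:].
HB.instance Definition _ := [SubChoice_isSubLmodule of submodule_type by <:].
End SubmoduleType.

(** The graph [L] of a partial endomorphism is itself a submodule of Q x Q on which the first
    projection is injective. Extending the second projection along the first gives an endomorphism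
    of the right module Q, that is, left multiplication by the image of 1. *)
Lemma self_injective_rel (Q : pzRingType) (L : set (Q * Q)) :
    right_self_injective Q -> L (0, 0) ->
    (forall p q a, L p -> L q -> L (p.1 * a + q.1, p.2 * a + q.2)) ->
    (forall y, L (0, y) -> y = 0) ->
  exists n, forall p, L p -> p.2 = n * p.1.
Proof.
move=> inj L0 Llin Lfun.
pose V : lmodType Q^c := (regular_rmod Q * regular_rmod Q)%type.
have HL : @submodule _ V L.
  split; first exact: mem_set.
  by move=> a p q /set_mem Lp /set_mem Lq; apply: mem_set; apply: Llin.
pose i : {linear submodule_type HL -> regular_rmod Q} :=
  (fst : {linear V -> regular_rmod Q}) \o
  (val : {linear submodule_type HL -> V}).
pose f : {linear submodule_type HL -> regular_rmod Q} :=
  (snd : {linear V -> regular_rmod Q}) \o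
  (val : {linear submodule_type HL -> V}).
have ii : injective i.
  apply: raddf_inj => -[[x y] Lxy] /= x0; apply: val_inj => /=.
  by move: (set_mem Lxy); rewrite x0 => /Lfun ->.
have [g gP] := inj _ _ i f ii.
exists (g 1) => p Lp.
have := gP (exist _ p (mem_set Lp)); rewrite /i /f /= => <-.
rewrite -[X in g X](mul1r (p.1 : Q)).
exact: (linearZ_LR g p.1 1).
Qed.

(** * Annihilators and abelian corners in regular rings *)

Section RegularRing.
Variable Q : pzRingType.
Hypothesis vnr : von_neumann_regular Q.

(** If [a * c * z * (a * c) = a * c], then [c * z * a * c] is an idempotent with the same right
    annihilator in c Q as [a]; [f] is its complement in [c]. *)
Lemma idempotent_annihilator (c a : Q) : c * c = c ->
  exists f, [/\ f * f = f, c * f = f, a * f = 0 &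
    forall x, c * x = x -> a * x = 0 -> f * x = x].
Proof.
move=> cc; have [z azc] := vnr (a * c).
have [f fE] : exists f, f = c - c * z * a * c by eexists.
have cf : c * f = f by rewrite fE mulrBr !mulrA cc.
have af : a * f = 0 by rewrite fE mulrBr -{1}azc !mulrA subrr.
exists f; split=> // [|x cx ax].
  by rewrite {1}fE mulrBl -!mulrA cf af !mulr0 subr0.
by rewrite fE mulrBl -!mulrA cx ax !mulr0 subr0.
Qed.

(** The second hypothesis makes the idempotents of h Q h central there. For a quasi-inverse [y] of
    [s] in the corner, [s * y] and [y * s] are then central idempotents, hence equal. *)
Lemma abelian_corner_group_inverse (h : Q) : h * h = h ->
    (forall e r : Q, e * e = e -> h * e = e -> e * h = e -> e * r * (h - e) = 0) ->
  forall s, h * s = s -> s * h = s ->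
  exists s', [/\ h * s' = s', s' * h = s', s * s' * s = s, s' * s * s' = s' &
     s * s' = s' * s].
Proof.
move=> hh ab s hs sh; have [y0 sys0] := vnr s.
have [y yE] : exists y, y = h * y0 * h by eexists.
have hy : h * y = y by rewrite yE !mulrA hh.
have yh : y * h = y by rewrite yE -mulrA hh.
have sys : s * y * s = s by rewrite yE !mulrA sh -mulrA hs.
(* Both e z (h - e) and (h - e) z e vanish, so e z and z e equal e z e. *)
have central e z : e * e = e -> h * e = e -> e * h = e -> h * z = z -> z * h = z ->
    e * z = z * e.
  move=> ee he eh hz zh.
  have := ab e z ee he eh; rewrite mulrBr -mulrA zh => /eqP.
  rewrite subr_eq0 => /eqP ->.
  have k1 : (h - e) * (h - e) = h - e.
    by rewrite mulrBr !mulrBl hh he eh ee subrr subr0.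
  have := ab (h - e) z k1; rewrite mulrBr mulrBl hh he eh => /(_ erefl erefl).
  rewrite opprB addrCA subrr addr0 !mulrBl hz => /eqP.
  by rewrite subr_eq0 => /eqP ->.
have e1 : s * y * (s * y) = s * y by rewrite mulrA sys.
have e2 : y * s * (y * s) = y * s by rewrite -mulrA (mulrA s) sys.
have C1 z : h * z = z -> z * h = z -> s * y * z = z * (s * y).
  by apply: central; rewrite // ?mulrA ?hs // -mulrA yh.
have C2 z : h * z = z -> z * h = z -> y * s * z = z * (y * s).
  by apply: central; rewrite // ?mulrA ?hy // -mulrA sh.
have E : s * y = y * s.
  have -> : s * y = y * s * (s * y).
    by rewrite mulrA (C2 s hs sh) -[in RHS](mulrA s) -mulrA -{1}e1 !mulrA.
  rewrite -(C1 (y * s)) ?mulrA ?hy //; last by rewrite -mulrA sh.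
  by rewrite (C1 y hy yh) !mulrA -!mulrA (mulrA s) sys.
exists (y * s * y); split.
- by rewrite !mulrA hy.
- by rewrite -mulrA yh.
- by rewrite !mulrA !sys.
- by rewrite -!mulrA (mulrA s) (mulrA _ s) sys (mulrA s) (mulrA _ s) sys.
- by rewrite !mulrA sys -mulrA e2.
Qed.

(** * A maximal partial isomorphism and its abelian complement *)

(* Taking p or q to be 0, the second condition also makes G functional and
   injective. *)
Definition disjoint_graph (G : set (Q * Q)) :=
  (forall p q a, G p -> G q -> G (p.1 * a + q.1, p.2 * a + q.2)) /\
  (forall p q, G p -> G q -> p.1 = q.2 -> p = (0, 0) /\ q = (0, 0)).

Lemma maximal_disjoint_graph : exists G : set (Q * Q),
  [/\ disjoint_graph G, G (0, 0) &
      forall B, disjoint_graph B -> G `<=` B -> B `<=` G].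
Proof.
have [F FP Ftot|G [GP Gmax]] := @Zorn_bigcup _ disjoint_graph.
  have pair p q : (\bigcup_(X in F) X) p -> (\bigcup_(X in F) X) q ->
      exists X, [/\ F X, X p & X q].
    move=> [X FX Xp] [Y FY Yq]; have [XY|YX] := Ftot _ _ FX FY.
      by exists Y; split=> //; apply: XY.
    by exists X; split=> //; apply: YX.
  split=> [p q a Up Uq|p q Up Uq]; have [X [FX Xp Xq]] := pair _ _ Up Uq.
    by exists X => //; apply: (FP X FX).1.
  exact: (FP X FX).2.
have {}Gmax B : disjoint_graph B -> G `<=` B -> B `<=` G.
  move=> BP GB; apply: contrapT => BG; exact: (Gmax B).
exists G; split=> //.
(* The empty set is also a [disjoint_graph], so (0, 0) has to come from maximality. *)
have [//|G0] := pselect (G (0, 0)).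
apply: (Gmax [set (0, 0)]) => //.
  split=> [p q a -> ->|p q -> -> //] /=; by rewrite mul0r addr0.
move=> p Gp; case: G0; have := GP.1 _ _ (- 1) Gp Gp.
by rewrite !mulrN1 !addNr.
Qed.

Hypothesis inj : right_self_injective Q.

(** A nonzero e r (h - e) would yield nonzero isomorphic right ideals inside e Q and (h - e) Q, and
    with them a proper extension of the maximal graph. *)
Lemma abelian_complement : exists f g a b : Q,
  [/\ f * f = f, g * g = g, f * g = 0 & g * f = 0] /\
  [/\ a * b = f, b * a = g, f * a = a & b * f = b] /\
  [/\ g * b = b, a * g = a & forall e r, let h := 1 - f - g in
    e * e = e -> h * e = e -> e * h = e -> e * r * (h - e) = 0].
Proof.
have [G [[Glin Gdis] G0 Gmax]] := maximal_disjoint_graph.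
have GZ p a : G p -> G (p.1 * a, p.2 * a).
  by move=> Gp; have := Glin _ _ a Gp G0; rewrite /= !addr0.
have GB p q : G p -> G q -> G (p.1 - q.1, p.2 - q.2).
  by move=> Gp Gq; have := Glin _ _ (- 1) Gq Gp; rewrite /= !mulrN1 ![- _ + _]addrC.
have Gdis' p q : G p -> G q -> p.1 + q.2 = 0 -> p = (0, 0) /\ q = (0, 0).
  move=> Gp Gq pq; have := Gdis p (q.1 * -1, q.2 * -1) Gp (GZ _ _ Gq) => /=.
  rewrite !mulrN1; case; first by apply/eqP; rewrite -addr_eq0 pq.
  move=> -> [/eqP]; rewrite oppr_eq0 => /eqP q1 /eqP; rewrite oppr_eq0 => /eqP q2.
  by rewrite [q]surjective_pairing q1 q2.
(* [n] extends the partial map [G] by zero on its range; [y] below extends the inverse of [G] by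
   zero on its domain. *)
have [n nP] : exists n, forall p,
    (exists p' q', [/\ G p', G q' & p = (p'.1 + q'.2, p'.2)]) ->
    p.2 = n * p.1.
  apply: (self_injective_rel inj).
  - by exists (0, 0), (0, 0); rewrite /= addr0.
  - move=> _ _ a [p [q [Gp Gq ->]]] [p' [q' [Gp' Gq' ->]]] /=.
    exists (p.1 * a + p'.1, p.2 * a + p'.2), (q.1 * a + q'.1, q.2 * a + q'.2).
    by split; [apply: Glin|apply: Glin|rewrite /= mulrDl addrACA].
  - move=> y [p [q [Gp Gq [/esym pq ->]]]].
    by have [-> _] := Gdis' _ _ Gp Gq pq.
have [y yP] : exists n, forall p,
    (exists p' q', [/\ G p', G q' & p = (p'.1 + q'.2, q'.1)]) ->
    p.2 = n * p.1.
  apply: (self_injective_rel inj).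
  - by exists (0, 0), (0, 0); rewrite /= addr0.
  - move=> _ _ a [p [q [Gp Gq ->]]] [p' [q' [Gp' Gq' ->]]] /=.
    exists (p.1 * a + p'.1, p.2 * a + p'.2), (q.1 * a + q'.1, q.2 * a + q'.2).
    by split; [apply: Glin|apply: Glin|rewrite /= mulrDl addrACA].
  - move=> z [p [q [Gp Gq [/esym pq ->]]]].
    by have [_ ->] := Gdis' _ _ Gp Gq pq.
have n1 p : G p -> n * p.1 = p.2.
  by move=> Gp; rewrite -(nP (p.1, p.2)) //; exists p, (0, 0); rewrite /= addr0.
have n2 p : G p -> n * p.2 = 0.
  by move=> Gp; rewrite -(nP (p.2, 0)) //; exists (0, 0), p; rewrite /= add0r.
have y1 p : G p -> y * p.1 = 0.
  by move=> Gp; rewrite -(yP (p.1, 0)) //; exists p, (0, 0); rewrite /= addr0.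
have y2 p : G p -> y * p.2 = p.1.
  by move=> Gp; rewrite -(yP (p.2, p.1)) //; exists (0, 0), p; rewrite /= add0r.
(* [f] will generate the right ideal of all x with y n x = x, n n x = 0 and y x = 0, which contains
   the domain of [G]. *)
have [c1 [cc1 _ c1P c1m]] := @idempotent_annihilator 1 (1 - y * n) (mul1r 1).
have [c2 [cc2 c12 c2P c2m]] := @idempotent_annihilator c1 (n * n) cc1.
have [f [ff c2f yf fm]] := @idempotent_annihilator c2 y cc2.
have {fm} Gf p : G p -> f * p.1 = p.1.
  move=> Gp; apply: fm; last exact: y1.
  apply: c2m; last by rewrite -mulrA n1 ?n2.
  by apply: c1m; rewrite ?mul1r // mulrBl mul1r -mulrA n1 ?y2 ?subrr.
have nnf : n * n * f = 0 by rewrite -c2f mulrA c2P mul0r.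
have ynf : y * n * f = f.
  apply/eqP; rewrite eq_sym -subr_eq0 -[X in X - _]mul1r -mulrBl.
  by rewrite -c2f -c12 !mulrA c1P !mul0r.
have [m mE] : exists m, m = n * f by eexists.
have mf : m * f = m by rewrite mE -mulrA ff.
have ym : y * m = f by rewrite mE mulrA.
have [g gE] : exists g, g = m * y by eexists.
have gm : g * m = m by rewrite gE -mulrA ym.
have gg : g * g = g by rewrite {2}gE mulrA gm.
have gf : g * f = 0 by rewrite gE -mulrA yf mulr0.
(* So far only [g * f = 0] is known. [f1] generates the same right ideal as [f] and satisfies
   [f1 * g = 0] as well. *)
have [f1 f1E] : exists f1, f1 = f * (1 - g) by eexists.
have f1f : f1 * f = f by rewrite f1E -mulrA mulrBl mul1r gf subr0.
have ff1 : f * f1 = f1 by rewrite f1E mulrA ff.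
have ff11 : f1 * f1 = f1 by rewrite {2}f1E mulrA f1f.
have f1g : f1 * g = 0 by rewrite f1E -mulrA mulrBl mul1r gg subrr mulr0.
have gf1 : g * f1 = 0 by rewrite f1E mulrA gf mul0r.
have yg : y * g = f * y by rewrite gE mulrA ym.
have mf1yg : m * f1 * y * g = g.
  by rewrite -mulrA yg mulrA -(mulrA m) f1f mf.
exists f1, g, (f1 * y * g), (g * m * f1); split=> //; split.
  split.
  - by rewrite gm !mulrA -(mulrA (f1 * y)) gm -(mulrA f1) ym f1f ff1.
  - by rewrite gm !mulrA -(mulrA m) ff11 mf1yg.
  - by rewrite !mulrA ff11.
  - by rewrite -mulrA ff11.
split; [by rewrite !mulrA gg|by rewrite -mulrA gg|].
move=> e r h ee he eh.
have hf : h * f = 0 by rewrite /h !mulrBl mul1r f1f gf subr0 subrr.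
have f1m : f1 * m = 0 by rewrite f1E -mulrA mulrBl mul1r gm subrr mulr0.
have hm : h * m = 0 by rewrite /h !mulrBl mul1r f1m gm subr0 subrr.
have hh : h * h = h.
  rewrite {2}/h !mulrBr mulr1 {2 3}/h !mulrBl !mul1r ff11 gg gf1 f1g.
  by rewrite !subr0 !subrr !subr0.
clearbody h; have [z zE] : exists z, z = e * r * (h - e) by eexists.
rewrite -zE.
have k1 : (h - e) * (h - e) = h - e.
  by rewrite mulrBr !mulrBl hh he eh ee subrr subr0.
have zk : z * (h - e) = z by rewrite zE -mulrA k1.
have ez : e * z = z by rewrite zE !mulrA ee.
have hz : h * z = z by rewrite zE !mulrA he.
have kz : (h - e) * z = 0 by rewrite mulrBl hz ez subrr.
have [z' zz'] := vnr z.
(* [q] has the same right annihilator as [z], so q v |-> z v is an isomorphism from a right ideal in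
   (h - e) Q onto one in e Q. [B] adjoins it to the map [m] on f Q. *)
have [q qE] : exists q, q = (h - e) * z' * z by eexists.
have zq : z * q = z by rewrite qE !mulrA zk.
have hq : h * q = q by rewrite qE !mulrA mulrBr hh he.
have kq : (h - e) * q = q by rewrite qE !mulrA k1.
pose B : set (Q * Q) := [set p | exists x v, p = (f * x + q * v, m * x + z * v)].
have Bdis : disjoint_graph B.
  split=> [_ _ a [x [v ->]] [x' [v' ->]]|_ _ [x [v ->]] [x' [v' ->]]] /=.
    exists (x * a + x'), (v * a + v').
    by rewrite !mulrDr !mulrDl !mulrA; congr pair; rewrite addrACA.
  move=> E.
  (* [h] kills [f] and [m]; the two sides then lie in (h - e) Q and e Q, so both are zero. *)
  have E1 : q * v = z * v'.
    have := congr1 ( *%R h) E.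
    by rewrite !mulrDr !mulrA hf hm hq hz !mul0r !add0r.
  have qv : q * v = 0.
    by rewrite -kq -mulrA E1 mulrA kz mul0r.
  have zv' : z * v' = 0 by rewrite -E1.
  have E2 : f * x = m * x' by move: E; rewrite qv zv' !addr0.
  have fx' : f * x' = 0 by rewrite -ym -mulrA -E2 mulrA yf mul0r.
  have mx' : m * x' = 0 by rewrite -mf -mulrA fx' mulr0.
  have fx : f * x = 0 by rewrite E2.
  have mx : m * x = 0 by rewrite -mf -mulrA fx mulr0.
  have zv : z * v = 0 by rewrite -zq -mulrA qv mulr0.
  have qv' : q * v' = 0 by rewrite qE -mulrA zv' mulr0.
  by rewrite fx qv mx zv fx' mx' qv' zv' !addr0.
have GBs : G `<=` B.
  move=> p Gp; exists p.1, 0; rewrite !mulr0 !addr0 mE -mulrA Gf // n1 //.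
  exact: surjective_pairing.
have Gqz : G (q, z).
  by apply: (Gmax B) => //; exists 0, 1; rewrite !mulr0 !mulr1 !add0r.
have /= fq := Gf _ Gqz.
have q0 : q = 0 by rewrite -hq -fq mulrA hf mul0r.
by rewrite -zq q0 mulr0.
Qed.
End RegularRing.

(** * Regularity of subrings that contain all units *)

Section UnitSubring.
Variables (Q : pzRingType) (T : set Q).
Hypothesis TB : forall x y, T x -> T y -> T (x - y).
Hypothesis TM : forall x y, T x -> T y -> T (x * y).
Hypothesis TU : forall x y, x * y = 1 -> y * x = 1 -> T x.

Let T1 : T 1. Proof. by apply: (@TU 1 1); rewrite mulr1. Qed.
Let TD x y : T x -> T y -> T (x + y).
Proof.
move=> Tx Ty; rewrite -[y]opprK; apply: TB => //.
by rewrite -[- y]add0r; apply: TB => //; rewrite -(subrr 1); apply: TB.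
Qed.

Lemma square_zero_mem z : z * z = 0 -> T z.
Proof.
move=> zz; rewrite -[z](addrK 1); apply: TB => //.
apply: (@TU _ (1 - z)).
  by rewrite mulrDl mulrBr mulrBr mul1r mulr1 zz subr0 mul1r addrC subrK.
by rewrite mulrBl mul1r mulrDr mulr1 zz add0r addrAC subrr add0r.
Qed.

(* [f x f = (f x a) b] is a product of two elements of square zero. *)
Lemma idempotent_ideal_mem f a b : a * b = f -> f * f = f ->
    a * f = 0 -> f * b = 0 -> b * f = b ->
  forall x, T (f * x) /\ T (x * f).
Proof.
move=> ab ff af fb bf x.
have Tf : T (f * x * f).
  rewrite -[X in _ * X]ab mulrA; apply: TM; apply: square_zero_mem.
    by rewrite !mulrA -(mulrA _ a f) af mulr0 !mul0r.
  by rewrite -{1}bf -mulrA fb mulr0.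
split.
  (* The difference is f x (1 - f), of square zero. *)
  rewrite -[f * x](subrK (f * x * f)); apply: TD => //; apply: square_zero_mem.
  have fw : f * (f * x - f * x * f) = f * x - f * x * f.
    by rewrite mulrBr !mulrA ff.
  by rewrite -{2}fw mulrA mulrBl -(mulrA _ f f) ff subrr mul0r.
rewrite -[x * f](subrK (f * x * f)); apply: TD => //; apply: square_zero_mem.
have wf : (x * f - f * x * f) * f = x * f - f * x * f.
  by rewrite mulrBl -!(mulrA _ f f) ff.
by rewrite -{1}wf -mulrA mulrBr !mulrA ff subrr mulr0.
Qed.

Hypothesis vnr : von_neumann_regular Q.
Hypothesis inj : right_self_injective Q.

Lemma unit_subring_regular t : T t -> exists2 s, T s & t * s * t = t.
Proof.
move=> Tt.
have [f [g [a [b [[ff gg fg gf] [[ab ba fa bf] [gb ag abel]]]]]]] :=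
  abelian_complement vnr inj.
have af : a * f = 0 by rewrite -ag -mulrA gf mulr0.
have fb : f * b = 0 by rewrite -gb mulrA fg mul0r.
have bg : b * g = 0 by rewrite -bf -mulrA fg mulr0.
have ga : g * a = 0 by rewrite -fa mulrA gf mul0r.
have fmem := idempotent_ideal_mem ab ff af fb bf.
have gmem := idempotent_ideal_mem ba gg bg ga ag.
(* All left and right multiples of [k] lie in [T], so only the corner at h = 1 - k remains. *)
have [k kE] : exists k, k = f + g by eexists.
have [h hE] : exists h, h = 1 - f - g by eexists.
have Tkl x : T (k * x).
  by rewrite kE mulrDl; apply: TD; [case: (fmem x)|case: (gmem x)].
have Tkr x : T (x * k).
  by rewrite kE mulrDr; apply: TD; [case: (fmem x)|case: (gmem x)].
have hk1 : h + k = 1 by rewrite hE kE -(addrA 1) -opprD subrK.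
have kk : k * k = k by rewrite kE mulrDl !mulrDr ff gg fg gf addr0 add0r.
have kh : k * h = 0.
  by rewrite -[h](addrK k) hk1 mulrBr mulr1 kk subrr.
have hk : h * k = 0.
  by rewrite -[h](addrK k) hk1 mulrBl mul1r kk subrr.
have hh : h * h = h by rewrite -{3}[h]mulr1 -hk1 mulrDr hk addr0.
have hB x : h * x = x - k * x by rewrite -[h](addrK k) hk1 mulrBl mul1r.
have Bh x : x * h = x - x * k by rewrite -[h](addrK k) hk1 mulrBr mulr1.
have Ths x : T x -> T (h * x) by move=> Tx; rewrite hB; apply: TB.
have Tsh x : T x -> T (x * h) by move=> Tx; rewrite Bh; apply: TB.
rewrite -hE in abel.
have [s sE] : exists s, s = h * t * h by eexists.
have hs : h * s = s by rewrite sE !mulrA hh.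
have sh : s * h = s by rewrite sE -mulrA hh.
have Ts : T s by rewrite sE; apply/Tsh/Ths.
have [s' [hs' s'h ss's s'ss' ss']] := abelian_corner_group_inverse vnr hh abel hs sh.
have [p pE] : exists p, p = s * s' by eexists.
have hp : h * p = p by rewrite pE mulrA hs.
have ph : p * h = p by rewrite pE -mulrA s'h.
have s'p : s' * p = s' by rewrite pE mulrA.
have pp : p * p = p by rewrite {1}pE -mulrA s'p -pE.
have hpl x : h * x = x -> k * x = 0 by move=> <-; rewrite mulrA kh mul0r.
have hpr x : x * h = x -> x * k = 0 by move=> <-; rewrite -mulrA hk mulr0.
have [d dE] : exists d, d = h - p by eexists.
have hd : h * d = d by rewrite dE mulrBr hh hp.
have dh : d * h = d by rewrite dE mulrBl hh ph.
have dd : d * d = d by rewrite {1}dE mulrBl hd dE mulrBr ph pp subrr subr0.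
(* As [k], [p] and [d] are orthogonal idempotents with sum 1, mutually inverse elements of p Q p
   extend by [k] and [d] to units of Q. *)
have inverse x y : h * x = x -> x * h = x -> h * y = y -> y * h = y ->
    x * y = p -> x * p = x -> p * y = y -> (k + (x + d)) * (k + (y + d)) = 1.
  move=> hx xh hy yh xy xp py.
  have xd : x * d = 0 by rewrite dE mulrBr xh xp subrr.
  have dy : d * y = 0 by rewrite dE mulrBl hy py subrr.
  rewrite !(mulrDl, mulrDr) kk (hpl y) // (hpl d) // (hpr x) // (hpr d) //.
  by rewrite xy xd dy dd !(addr0, add0r) dE (addrC p) subrK addrC.
have xp : s * p = s by rewrite pE ss' mulrA.
have px : p * s = s by rewrite pE.
have ps' : p * s' = s' by rewrite pE ss'.
have Tw : T (k + (s + d)).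
  by apply: (TU (y := k + (s' + d))); apply: inverse; rewrite // -ss' pE.
have Tw' : T (k + (s' + d)).
  by apply: (TU (y := k + (s + d))); apply: inverse; rewrite // -ss' pE.
have Tk : T k by rewrite -[k]mulr1.
have Td : T d.
  rewrite (_ : d = (k + (s + d)) - k - s); first by apply: TB => //; apply: TB.
  by rewrite (addrC k) addrK addrAC subrr add0r.
have Ts' : T s'.
  rewrite (_ : s' = (k + (s' + d)) - k - d); first by apply: TB => //; apply: TB.
  by rewrite (addrC k) !addrK.
(* Subtracting t s' t clears the corner at [h], since h t s' t h = s s' s = s. What is left is k x +
   h x k. *)
have [x xE] : exists x, x = t - t * s' * t by eexists.
have hxh : h * x * h = 0.
  rewrite xE mulrBr mulrBl -sE -ss's sE !mulrA.
  by rewrite -(mulrA (h * t) h) hs' -(mulrA (h * t) s') s'h subrr.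
have [y xyx] := vnr x.
(* [y] itself need not lie in [T], but each term of y x y has an inner factor [k], hence is a
   right-hand multiple of [k] times a left-hand one. *)
have Ty : T (y * x * y).
  have -> : x = k * (k * x) + (h * x * k) * k.
    have hx : h * x = h * x * k by rewrite -{1}[h * x]mulr1 -hk1 mulrDr hxh add0r.
    by rewrite mulrA kk -(mulrA (h * x)) kk -hx -mulrDl addrC hk1 mul1r.
  rewrite mulrDr mulrDl; apply: TD.
    have -> : y * (k * (k * x)) * y = (y * k) * (k * (x * y)) by rewrite !mulrA.
    exact: TM.
  have -> : y * (h * x * k * k) * y = (y * h * x * k) * (k * y) by rewrite !mulrA.
  exact: TM.
(* McCoy's formula: a quasi-inverse of t - t s' t corrects [s'] to a quasi-inverse of [t]. *)
exists (s' + (1 - s' * t) * (y * x * y) * (1 - t * s')).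
  have Tts : T (t * s') by apply: TM.
  have Tst : T (s' * t) by apply: TM.
  by apply: TD => //; apply: TM; [apply: TM => //|]; apply: TB.
have x1 : t * (1 - s' * t) = x by rewrite mulrBr mulr1 mulrA.
have x2 : (1 - t * s') * t = x by rewrite mulrBl mul1r.
by rewrite mulrDr mulrDl !mulrA x1 -(mulrA _ (1 - t * s')) x2 xyx xyx xE addrC subrK.
Qed.

End UnitSubring.

(** * Units and idempotents modulo the Jacobson radical *)

Section JacobsonUnits.
Variable S : pzRingType.

Lemma right_ideal_maximal (I : set S) : right_ideal I -> ~ I 1 ->
  exists2 m, maximal_right_ideal m & I `<=` m.
Proof.
move=> /right_idealP[I0 Ilin] I1.
(* The last clause requires [I] inside [A] only for inhabited [A], so that the union of the empty
   chain satisfies [P]. *)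
pose P (A : set S) := [/\ forall a x y, A x -> A y -> A (x * a + y), ~ A 1 &
  forall x, A x -> I `<=` A].
have [F FP Ftot|m [[mlin m1 mI] mmax]] := @Zorn_bigcup _ P.
  split=> [a x y [A FA Ax] [B FB By]|[A /FP[]//]|x [A FA Ax] z Iz].
    have [AB|BA] := Ftot _ _ FA FB.
      by exists B => //; have [Bl _ _] := FP B FB; apply: Bl => //; apply: AB.
    by exists A => //; have [Al _ _] := FP A FA; apply: Al => //; apply: BA.
  by exists A => //; have [_ _ AI] := FP A FA; exact: (AI x Ax z Iz).
have Im : I `<=` m.
  apply: contrapT => nIm; apply: (mmax I); last by split=> // x _ z.
  by split=> [x mx|Im]; [case: nIm; exact: (mI x)|apply: nIm].
exists m => //; split.
- by apply/right_idealP; split=> //; apply: Im.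
- by move=> mT; apply: m1; rewrite mT.
move=> J /right_idealP[J0 Jlin] mJ.
have [J1|nJ1] := pselect (J 1).
  right; apply/seteqP; split=> // y _; rewrite -[y]mul1r -[_ * _]addr0.
  exact: Jlin.
left; apply/seteqP; split=> //; apply: contrapT => Jm.
by apply: (mmax J); split=> // x _ z /Im /mJ.
Qed.

(* A pzRingType has no GRing.unit predicate. *)
Definition is_unit (x : S) := exists y, x * y = 1 /\ y * x = 1.

Lemma is_unit_of_inverses (x y z : S) : x * y = 1 -> z * x = 1 -> is_unit x.
Proof.
move=> xy zx; exists y; split=> //.
by rewrite -[y]mul1r -zx -(mulrA z) xy mulr1.
Qed.

Lemma jacobson_is_unit (j : S) : j \in jacobson S -> is_unit (1 + j).
Proof.
(* If (1 + x) S were proper, a maximal right ideal above it would contain [x], hence 1. *)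
have rinv x : x \in jacobson S -> exists y, (1 + x) * y = 1.
  move=> /asboolP Jx; apply: contrapT => nx.
  pose I : set S := [set z | exists y, z = (1 + x) * y].
  have [||m mm Im] := @right_ideal_maximal I.
  - apply/right_idealP; split; first by exists 0; rewrite mulr0.
    by move=> a _ _ [y ->] [z ->]; exists (y * a + z); rewrite mulrDr mulrA.
  - by move=> [y y1]; apply: nx; exists y.
  have [mI mT _] := mm; have [m0 mlin] := (right_idealP m).1 mI.
  have m1 : m 1.
    rewrite -[1](addrK x) addrC -mulrN1; apply: mlin; first exact: Jx.
    by apply: Im; exists 1; rewrite mulr1.
  apply: mT; apply/seteqP; split=> // y _.
  by rewrite -[y]mul1r -[_ * _]addr0; apply: mlin.
(* The right inverse [v] = 1 - j v is again 1 plus a radical element, so it has a right inverse too,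
   which must be 1 + j. *)
move=> Jj; have [v jv] := rinv j Jj.
have vE : v = 1 - j * v by rewrite -jv mulrDl mul1r addrK.
have [|w vw] := rinv (- (j * v)); first by rewrite rpredN; apply: jacobsonMr.
rewrite -vE in vw; exists v; split=> //.
suff <- : w = 1 + j by [].
by rewrite -[LHS]mul1r -[X in X * w]jv -mulrA vw mulr1.
Qed.

Local Notation Q := (jacobson_quot S).

Lemma jquot_pi1 : \pi_Q 1 = 1.
Proof. by rewrite [RHS]/GRing.one /=; unlock jquot1. Qed.

Lemma jquot_pi_mul (x y : S) : \pi_Q x * \pi_Q y = \pi_Q (x * y).
Proof. exact: jquot_piM. Qed.

Lemma jquot_is_unit_lift (x y : S) :
  \pi_Q x * \pi_Q y = 1 -> \pi_Q y * \pi_Q x = 1 -> is_unit x.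
Proof.
have unit z : \pi_Q z = 1 -> is_unit z.
  rewrite -jquot_pi1 => /jquot_eqP /jacobson_is_unit.
  by rewrite addrC subrK.
rewrite !jquot_pi_mul =>  /unit[v [xyv _]] /unit[w [_ wyx]].
by apply: (@is_unit_of_inverses _ (y * v) (w * y)); rewrite ?mulrA // -mulrA.
Qed.

Lemma unit_subring_exchange (E : set S) :
    von_neumann_regular Q -> right_self_injective Q ->
    idempotents_lift (jacobson S) ->
    (forall x y, E x -> E y -> E (x - y)) ->
    (forall x y, E x -> E y -> E (x * y)) ->
    (forall x, is_unit x -> E x) ->
  forall a, E a -> exists b c, [/\ E b, E c,
    b * a * (b * a) = b * a & 1 - b * a = c * (1 - a)].
Proof.
move=> vnr inj lift EB EM EU a Ea.
have E1 : E 1 by apply: (EU); exists 1; rewrite mulr1.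
have ED x y : E x -> E y -> E (x + y).
  move=> Ex Ey; rewrite -[y]opprK; apply: (EB) => //.
  by rewrite -[- y]add0r; apply: (EB) => //; rewrite -(subrr 1); apply: (EB).
have EJ j : j \in jacobson S -> E j.
  by move=> /jacobson_is_unit /EU E1j; rewrite -[j](addKr 1) addrC; apply: (EB).
pose T : set Q := [set x | exists2 g, E g & \pi_Q g = x].
have [||||_ [a' Ea' <-] /= aa'a] := @unit_subring_regular Q T _ _ _ vnr inj (\pi_Q a).
- move=> _ _ [x Ex <-] [y Ey <-]; exists (x - y); first exact: EB.
  exact: (raddfB (\pi_Q)).
- move=> _ _ [x Ex <-] [y Ey <-]; exists (x * y); first exact: EM.
  by rewrite -jquot_pi_mul.
- move=> x y; rewrite -[x]reprK -[y]reprK => xy yx; exists (repr x) => //.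
  by apply: (EU); apply: jquot_is_unit_lift xy yx.
- by exists a.
have Jaa : a * a' * a - a \in jacobson S.
  by apply/jquot_eqP; rewrite -!jquot_pi_mul.
have [v vE] : exists v, v = a' * a by eexists.
have [j jE] : exists j, j = a * v - a by eexists.
have Jj : j \in jacobson S by rewrite jE vE mulrA.
(* Chosen so that 1 - a0 = (1 - v) (1 - a): [a0] lies in E a, its complement in E (1 - a), and it is
   idempotent modulo the radical. *)
have [a0 a0E] : exists a0, a0 = (1 + a' - v) * a by eexists.
have Ev : E v by rewrite vE; apply: (EM).
have [w wE] : exists w, w = (1 - v) * (1 - a) by eexists.
have a0w : 1 - a0 = w.
  rewrite a0E wE 2!mulrBl mulrDl !mul1r mulrBr mulr1 vE !opprB opprD.
  by rewrite (addrCA (a' * a * a)) !addrA.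
have ww : w * w - w = (a' * j + (1 - v) * j) * (1 - a).
  have jv : (1 - a) * (1 - v) = 1 - v + j.
    by rewrite jE mulrBl mul1r mulrBr mulr1 opprB.
  have vv : (1 - v) * (1 - v) = 1 - v + a' * j.
    rewrite mulrBl mul1r mulrBr mulr1 opprB; congr (_ + _).
    by rewrite jE mulrBr {1}vE -mulrA -vE.
  have -> : w * w = (1 - v) * ((1 - a) * (1 - v)) * (1 - a) by rewrite wE !mulrA.
  rewrite jv (mulrDr (1 - v)) vv wE -mulrBl; congr (_ * _).
  by rewrite -(addrA (1 - v)) (addrC (1 - v)) addrK.
have Jw : a0 * a0 - a0 \in jacobson S.
  have -> : a0 * a0 - a0 = w * w - w.
    by rewrite -a0w mulrBl mul1r addrAC subrr add0r mulrBr mulr1 opprB.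
  by rewrite ww; apply: jacobsonMr; apply: rpredD; apply: jacobsonMl.
have [f ff Jf] := lift _ Jw.
have [d dE] : exists d, d = f - a0 by eexists.
rewrite -dE in Jf.
have Ea0 : E a0 by rewrite a0E; apply: (EM) => //; apply: (EB) => //; apply: (ED).
have Ef : E f by rewrite -[f](subrK a0) -dE; apply: (ED) => //; apply: EJ.
(* [u] is 1 modulo the radical, f u = f a0 and (1 - f) u = (1 - f) (1 - a0). Conjugating [f] by [u]
   thus gives an exact idempotent in E a with complement in E (1 - a). *)
have [u uE] : exists u, u = f * a0 + (1 - f) * (1 - a0) by eexists.
have u1 : u = 1 + ((1 - f) * d - f * d).
  rewrite uE (_ : a0 = f - d); last by rewrite dE subKr.
  have -> : 1 - (f - d) = (1 - f) + d by rewrite opprB addrCA addrC.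
  have f1 : (1 - f) * (1 - f) = 1 - f.
    by rewrite mulrBl mul1r mulrBr mulr1 ff subrr subr0.
  rewrite mulrBr mulrDr ff f1 addrACA (addrC f) subrK.
  by rewrite (addrC (- _)).
have [y [uy yu]] : is_unit u.
  by rewrite u1; apply: jacobson_is_unit; apply: rpredB; apply: jacobsonMl.
have Ey : E y by apply: (EU); exists u.
have fu : f * u = f * a0.
  by rewrite uE mulrDr !mulrA ff (mulrBr f) mulr1 ff subrr mul0r addr0.
have ea : y * f * (1 + a' - v) * a = y * (f * u).
  by rewrite -mulrA -a0E -mulrA fu.
exists (y * f * (1 + a' - v)), (y * (1 - f) * (1 - v)); split.
- by apply: (EM); [exact: EM|apply: (EB) => //; exact: ED].
- by apply: (EM); [apply: (EM) => //|]; apply: (EB).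
- rewrite ea -(mulrA y) -(mulrA f u) (mulrA u y) uy mul1r.
  by rewrite (mulrA f f) ff.
by rewrite ea fu -{1}yu -mulrBr uE (addrC (f * a0)) addrK a0w wE !mulrA.
Qed.
End JacobsonUnits.

(** * Exchange rings and orthogonal idempotents *)

(** The Goodearl-Nicholson criterion, in its left-handed form. *)
Definition exchange_ring (E : pzRingType) := forall a : E,
  exists b c, b * a * (b * a) = b * a /\ 1 - b * a = c * (1 - a).

Section ExchangeRing.
Variable E : pzRingType.
Hypothesis exch : exchange_ring E.

(** The criterion passes to f E f: apply it to a + (1 - f), whose complement is f - a. *)
Lemma exchange_corner (f a : E) : f * f = f -> f * a = a -> a * f = a ->
  exists b c, [/\ b * a * (b * a) = b * a, f * (b * a) = b * a,
    b * a * f = b * a & f - b * a = c * (f - a)].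
Proof.
move=> ff fa af; have [b [c [ee eE]]] := exch (a + (1 - f)).
have [g gE] : exists g, g = 1 - b * (a + (1 - f)) by eexists.
have gc : g = c * (f - a) by rewrite gE eE opprD opprB addrCA [1 + _]addrC subrK addrC.
have gf : g * f = g by rewrite gc -mulrA mulrBl ff af.
have gg : g * g = g by rewrite gE mulrBr mulr1 mulrBl mul1r ee subrr subr0.
have fE : f - f * g = f * b * a.
  have e1 : f - f * g = f * (b * (a + (1 - f))).
    by rewrite gE mulrBr mulr1 subKr.
  rewrite -[LHS](_ : (f - f * g) * f = _); last by rewrite mulrBl ff -mulrA gf.
  rewrite e1 -!mulrA; congr (_ * (_ * _)).
  by rewrite mulrDl af mulrBl mul1r ff subrr addr0.
exists (f * b), (f * c); rewrite -fE.
have fefg : f * (f - f * g) = f - f * g by rewrite mulrBr mulrA ff.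
have efg : (f - f * g) * g = 0 by rewrite mulrBl -mulrA gg subrr.
have ef : (f - f * g) * f = f - f * g by rewrite mulrBl ff -mulrA gf.
split=> //.
  by rewrite {1}mulrBr ef mulrA ef efg subr0.
by rewrite subKr gc mulrA.
Qed.

(** By induction on [r]: split off an idempotent for the head in the corner at [f], treat the tail
    in the complementary corner at [h], then correct both. *)
Lemma exchange_orthogonal (I : eqType) (r : seq I) (a : I -> E) (f : E) :
    uniq r -> f * f = f -> (forall i, i \in r -> a i * f = a i) ->
    \sum_(i <- r) a i = f ->
  exists e x : I -> E, [/\ forall i, i \in r -> e i = x i * a i,
    {in r &, forall i k, e i * e k = if i == k then e i else 0},
    {in r, forall i, f * e i = e i} & \sum_(i <- r) e i = f].
Proof.
elim: r a f => [|i0 r IH] a f /=.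
  by move=> _ _ _ <-; exists a, (fun=> 0); split=> //; rewrite big_nil.
move=> /andP[i0r ur] ff af sumf.
have afr i : i \in r -> a i * f = a i by move=> ir; apply: af; rewrite inE ir orbT.
have af0 : a i0 * f = a i0 by apply: af; rewrite inE eqxx.
have [b [c [ee fe ef eE]]] : exists b c,
    [/\ b * (f * a i0) * (b * (f * a i0)) = b * (f * a i0),
    f * (b * (f * a i0)) = b * (f * a i0), b * (f * a i0) * f = b * (f * a i0)
    & f - b * (f * a i0) = c * (f - f * a i0)].
  by apply: exchange_corner; rewrite // ?mulrA ?ff // -mulrA af0.
have [e eeq] : exists e, e = b * (f * a i0) by eexists.
rewrite -eeq in ee fe ef eE.
have [h hE] : exists h, h = f - e by eexists.
have hh : h * h = h by rewrite hE mulrBr !mulrBl ff fe ef ee subrr subr0.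
have fh : f * h = h by rewrite hE mulrBr ff fe.
(* As h = c (f - f a_i0), the elements c f a_i h over the tail sum to [h]. *)
have [g [x [gx gg hg sumg]]] : exists g x : I -> E,
    [/\ forall i, i \in r -> g i = x i * (c * f * a i * h),
    {in r &, forall i k, g i * g k = if i == k then g i else 0},
    {in r, forall i, h * g i = g i} & \sum_(i <- r) g i = h].
  apply: IH => // [i ir|]; first by rewrite -mulrA hh.
  rewrite -mulr_suml -mulr_sumr -[RHS]hh; congr (_ * _).
  rewrite [RHS]hE eE -mulrA; congr (c * _).
  have -> : \sum_(i <- r) a i = f - a i0.
    by rewrite -sumf big_cons addrAC subrr add0r.
  by rewrite mulrBr ff.
(* [g i] lies only in E a_i h. Dropping the trailing [h] gives elements X_i a_i of E a_i that are
   still orthogonal idempotents. *)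
have [X XE] : exists X : I -> E, forall i, X i = g i * x i * c * f by eexists.
have Xgh i : i \in r -> X i * a i * h = g i.
  have ggi : i \in r -> g i * g i = g i by move=> ir; rewrite gg // eqxx.
  by move=> ir; rewrite XE -[RHS]ggi // [X in _ = _ * X]gx // !mulrA.
have hX i : i \in r -> h * (X i * a i) = X i * a i.
  by move=> ir; rewrite XE !mulrA hg.
have fX i : i \in r -> f * (X i * a i) = X i * a i.
  by move=> ir; rewrite -(hX i ir) mulrA fh.
have XX : {in r &, forall i k, X i * a i * (X k * a k) = if i == k then X i * a i else 0}.
  move=> i k ir kr; rewrite -(hX k kr) mulrA Xgh // XE !mulrA gg //.
  by case: eqP => [<-|_]; rewrite ?mul0r // XE.
have [F FE] : exists F, F = \sum_(i <- r) X i * a i by eexists.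
have Fh : F * h = h.
  by rewrite FE mulr_suml -[RHS]sumg; apply: eq_big_seq => i ir; rewrite Xgh.
have Ff : F * f = F.
  rewrite FE mulr_suml; apply: eq_big_seq => i ir.
  by rewrite -mulrA afr.
have fF : f * F = F.
  by rewrite FE mulr_sumr; apply: eq_big_seq => i ir; rewrite fX.
have FX i : i \in r -> F * (X i * a i) = X i * a i.
  by move=> ir; rewrite -(hX i ir) mulrA Fh.
have XF i : i \in r -> X i * a i * F = X i * a i.
  move=> ir; rewrite FE mulr_sumr (bigD1_seq i) //= XX // eqxx big1_seq ?addr0 //.
  by move=> k /andP[ki kr]; rewrite XX // eq_sym (negPf ki).
have FF : F * F = F.
  by rewrite {2}FE mulr_sumr {2}FE; apply: eq_big_seq => i ir; rewrite FX.
(* The head idempotent [e] is replaced by f - F, which equals (f - F) e because F h = h, and so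
   stays in E a_i0. *)
have e0E : f - F = (f - F) * b * f * a i0.
  rewrite -!mulrA -eeq (_ : e = f - h); last by rewrite hE subKr.
  by rewrite mulrBr !mulrBl ff Ff fh Fh subrr subr0.
pose e' i := if i == i0 then f - F else X i * a i.
have e'r i : i \in r -> e' i = X i * a i.
  by move=> ir; rewrite /e'; case: eqP => // ii0; rewrite ii0 (negPf i0r) in ir.
exists e', (fun i => if i == i0 then (f - F) * b * f else X i); split.
- by move=> i _; rewrite /e'; case: eqP => // ->.
- move=> i k; rewrite !inE.
  case/orP=> [/eqP ->|ir] /orP[/eqP ->|kr].
  + rewrite eqxx /e' eqxx mulrBr !mulrBl ff Ff fF FF subrr subr0 //.
  + rewrite (e'r k kr) /e' eqxx mulrBl fX // FX // subrr.
    by case: eqP => // ik; rewrite ik kr in i0r.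
  + rewrite (e'r i ir) /e' eqxx mulrBr XF // -mulrA afr // subrr.
    by case: eqP => // ik; rewrite -ik ir in i0r.
  + by rewrite !e'r // XX.
- move=> i; rewrite inE => /orP[/eqP ->|ir]; first by rewrite /e' eqxx mulrBr ff fF.
  by rewrite e'r // fX.
rewrite big_cons {1}/e' eqxx (eq_big_seq _ e'r) -FE subrK //.
Qed.
End ExchangeRing.

(** * From exchange rings to direct sum decompositions *)

Lemma linear_exists (R : pzRingType) (U V : lmodType R) (f : U -> V) :
  linear f -> exists g : {linear U -> V}, forall x, g x = f x.
Proof.
by move=> lf; exists (HB.pack_for {linear U -> V} f (GRing.isLinear.Build _ _ _ _ f lf)).
Qed.

Lemma submoduleP (R : pzRingType) (V : lmodType R) (A : set V) : submodule A <->
  A 0 /\ forall a x y, A x -> A y -> A (a *: x + y).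
Proof.
split=> [[A0 Alin]|[A0 Alin]].
  split=> [|a x y Ax Ay]; first exact: set_mem A0.
  by apply: set_mem; apply: (Alin a x y); apply: mem_set.
split; first exact: mem_set.
by move=> a x y /set_mem Ax /set_mem Ay; apply: mem_set; apply: Alin.
Qed.

Lemma direct_sum_proj (R : pzRingType) (V : lmodType R) (I : finType) (C : I -> set V) :
  direct_sum C -> exists p : I -> {linear V -> V},
  [/\ forall i x, C i (p i x), forall x, x = \sum_i p i x &
     forall (c : I -> V), (forall i, C i (c i)) -> forall i, p i (\sum_k c k) = c i].
Proof.
move=> [subC decC].
pose c x := projT1 (cid (decC x)).
have cC x i : C i (c x i).
  by rewrite /c; case: cid => d [[dC _] _] /=.
have cE x : x = \sum_i c x i.
  by rewrite /c; case: cid => d [[_ dE] _] /=.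
have cU x (d : I -> V) : (forall i, C i (d i)) -> x = \sum_i d i -> forall i, c x i = d i.
  move=> dC xd i; rewrite {1}/c; case: cid => d' [_ dU] /=.
  rewrite (dU [ffun k => d k]) ?ffunE //; split=> [k|]; first by rewrite ffunE.
  by rewrite xd; apply: eq_bigr => k _; rewrite ffunE.
have lin i : linear (c^~ i).
  move=> a x y /=; apply: (cU _ (fun k => a *: c x k + c y k)) => [k|].
    by have [_] := (submoduleP (C k)).1 (subC k); apply; apply: cC.
  by rewrite big_split /= -scaler_sumr -!cE.
have [p pE] : exists p : I -> {linear V -> V}, forall i x, p i x = c x i.
  exists (fun i => projT1 (cid (linear_exists (lin i)))) => i x.
  by case: cid.
exists p; split=> [i x|x|d dC i]; first by rewrite pE.
  by rewrite {1}[x]cE; apply: eq_bigr => i _; rewrite pE.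
by rewrite pE; apply: cU.
Qed.

Lemma endo_sumE (R : pzRingType) (V : lmodType R) (I : Type) (r : seq I)
  (f : I -> Endo V) x : (\sum_(i <- r) f i) x = \sum_(i <- r) f i x.
Proof. by elim: r => [|i r IH]; rewrite ?big_nil // !big_cons -IH. Qed.

Lemma big_option (V : nmodType) (I : finType) (F : option I -> V) :
  \sum_i F i = F None + \sum_i F (Some i).
Proof.
rewrite (bigD1 None) //=; congr (_ + _).
rewrite (reindex_omap Some id) /=; last by case.
by apply: eq_bigl => i; rewrite eqxx.
Qed.

Lemma exchange_ring_finite_exchange (R : pzRingType) (M : rmodType R) :
  exchange_ring (Endo M) -> finite_exchange M.
Proof.
move=> exch A M' N I C dMN dC [j jinj jM'].
have [q [qM qsum qU]] := direct_sum_proj dMN.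
have [p [pC psum pU]] := direct_sum_proj dC.
have [subC _] := dC; have [subMN _] := dMN.
have pv x : exists m, j m = q true x.
  by have := qM true x; rewrite /= -jM' => -[m _ <-]; exists m.
have [v vE] : exists v : {linear A -> M}, forall x, j (v x) = q true x.
  pose v x := projT1 (cid (pv x)).
  have vE x : j (v x) = q true x by rewrite /v; case: cid.
  have [|v' v'E] := @linear_exists _ _ _ v; last by exists v' => x; rewrite v'E.
  by move=> a x y; apply: jinj; rewrite linearP !vE linearP.
have vj m : v (j m) = m.
  apply: jinj; rewrite vE.
  have := qU (fun b : bool => if b then j m else 0).
  rewrite big_bool /= addr0 => -> //.
  case; first by rewrite -jM'; exists m.
  by have := ((submoduleP _).1 (subMN false)).1.
pose a i : Endo M := v \o p i \o j.
have suma : \sum_i a i = 1.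
  apply: endoP => m; rewrite endo_sumE /= -[RHS]vj [in RHS](psum (j m)).
  by rewrite raddf_sum.
have [|||e [x [ea ee _ sume]]] :=
  @exchange_orthogonal _ exch _ (index_enum I) a 1 (index_enum_uniq I).
- by rewrite mulr1.
- by move=> i _; rewrite mulr1.
- exact: suma.
have {}ea i m : e i m = x i (v (p i (j m))) by rewrite ea ?mem_index_enum.
have {}ee i k m : e i (e k m) = if i == k then e i m else 0.
  have := ee i k; rewrite !mem_index_enum => /(_ isT isT).
  by case: eqP => _ E; exact: (congr1 (fun h : Endo M => h m) E).
have {}sume m : \sum_i e i m = m by rewrite -endo_sumE sume.
(* The leading [e i] keeps the values in the i-th summand of M, so each term of [Phi] can be
   recovered by applying [e i]. *)
pose phi i y := e i (x i (v y)).
have phi0 i : phi i 0 = 0 by rewrite /phi !raddf0.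
have phiP i b y z : phi i (b *: y + z) = b *: phi i y + phi i z.
  by rewrite /phi !linearP.
(* [Phi] is a retraction of [j], so A is M' plus the kernel of [Phi]; that kernel is the sum of the
   kernels of the [phi i] on the [C i]. *)
pose Phi y := \sum_i phi i (p i y).
have Phij m : Phi (j m) = m.
  rewrite -[RHS]sume; apply: eq_bigr => i _.
  by rewrite /phi -ea ee eqxx.
have PhiB y z : Phi (y - z) = Phi y - Phi z.
  by rewrite /Phi -sumrB; apply: eq_bigr => i _; rewrite /phi !raddfB.
have ePhi i y : e i (Phi y) = phi i (p i y).
  rewrite /Phi raddf_sum (bigD1 i) //= big1 ?addr0; first by rewrite /phi ee eqxx.
  by move=> k ki; rewrite /phi ee eq_sym (negPf ki).
pose B i : set A := [set y | C i y /\ phi i y = 0].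
have subB i : submodule (B i).
  have [C0 Clin] := (submoduleP _).1 (subC i).
  apply/submoduleP; split=> [|b y z [Cy fy] [Cz fz]]; first by split.
  by split; [apply: Clin|rewrite phiP fy fz scaler0 addr0].
exists B; split=> [i|]; first by split=> // y [].
split=> [[i|] /=|y]; [exact: subB|exact: (subMN true)|].
pose z := y - j (Phi y).
have Phiz : Phi z = 0 by rewrite /z PhiB Phij subrr.
exists [ffun o => if o is Some i then p i z else j (Phi y)]; split.
  split=> [[i|]|]; rewrite ?ffunE /=.
  - by split; [exact: pC|rewrite -ePhi Phiz raddf0].
  - by rewrite -jM'; exists (Phi y).
  rewrite big_option ffunE; under eq_bigr do rewrite ffunE.
  by rewrite -psum /z addrC subrK.
move=> c [cB ycE]; rewrite big_option in ycE.
have cC i : C i (c (Some i)) by have [] := cB (Some i).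
have phic i : phi i (c (Some i)) = 0 by have [] := cB (Some i).
have [m _ jm] : range j (c None) by rewrite jM'; exact: (cB None).
have yc : y - c None = \sum_i c (Some i) by rewrite ycE addrAC subrr add0r.
have Phiy : Phi y = m.
  apply/eqP; rewrite -subr_eq0 -[X in _ - X]Phij jm -PhiB yc; apply/eqP.
  by apply: big1 => i _; rewrite (pU (fun i => c (Some i))).
have jz : j (Phi y) = c None by rewrite Phiy.
apply/ffunP => -[i|]; rewrite ffunE //.
by rewrite /z jz yc (pU (fun i => c (Some i))).
Qed.

(** * Envelopes and the passage from End(X) to End(M) *)

(** [automorphism_invariant] speaks of some envelope [u'], not of the given [u]. Envelopes are
    unique up to isomorphism, so [g] is transported to X' by conjugation. *)
Lemma automorphism_restricts (R : pzRingType) (XX : rmodType R -> Prop)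
    (M X : rmodType R) (u : {linear M -> X}) (g : {linear X -> X}) :
  envelope XX u -> automorphism_invariant XX M -> bijective g ->
  exists f : {linear M -> M}, forall x, u (f x) = g (u x).
Proof.
move=> [[XXX pre] env] [X' [u' [[[XXX' pre'] env'] inv]]] gbij.
have [al alE] := pre X' u' XXX'; have [be beE] := pre' X u XXX.
have ba : bijective (be \o al) by apply: (env (be \o al)) => x /=; rewrite alE beE.
have ab : bijective (al \o be) by apply: (env' (al \o be)) => x /=; rewrite beE alE.
(* Both composites of [al] and [be] fix an envelope map, hence are automorphisms. *)
have [w wK Kw] : bijective al.
  have [k1 k1K _] := ba; have [k2 _ Kk2] := ab.
  exists (k1 \o be) => x /=; first exact: k1K.
  by rewrite -[in LHS](Kk2 x) /= [k1 _](k1K (be (k2 x))); apply: Kk2.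
have wlin : linear w.
  by move=> a x y; apply: (can_inj wK); rewrite linearP !Kw.
have [w' w'E] := linear_exists wlin.
have [|f fE] := inv (al \o g \o w').
  have wb : bijective w' by exists al => x; rewrite w'E.
  by apply: bij_comp; [apply: bij_comp => //; exists w|].
exists f => x; apply: (can_inj wK).
by rewrite alE fE /= w'E -alE wK.
Qed.
Theorem corollary3p9 (R : pzRingType) (XX : rmodType R -> Prop)
    (XX_nonempty : exists X : rmodType R, XX X)
    (XX_iso : iso_closed XX)
    (M X : rmodType R) (u : {linear M -> X})
    (u_env : envelope XX u) (u_mono : injective u)
    (vnr : von_neumann_regular (jacobson_quot (Endo X)))
    (self_inj : right_self_injective (jacobson_quot (Endo X)))
    (lift : idempotents_lift (jacobson (Endo X)))
    (M_inv : automorphism_invariant XX M) :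
  finite_exchange M.
Proof.
apply: exchange_ring_finite_exchange => a.
pose ext (g : Endo X) (f : Endo M) := forall x, u (f x) = g (u x).
have extU g f f' : ext g f -> ext g f' -> f = f'.
  by move=> gf gf'; apply: endoP => x; apply: u_mono; rewrite gf gf'.
have extB g g' f f' : ext g f -> ext g' f' -> ext (g - g') (f - f').
  by move=> gf gf' x; rewrite /= raddfB /= gf gf'.
have extM g g' f f' : ext g f -> ext g' f' -> ext (g * g') (f * f').
  by move=> gf gf' x; rewrite /= gf gf'.
have ext1 : ext 1 1 by [].
(* Endomorphisms of M extend to X by the preenvelope property, so restriction from E to End(M) is
   onto. *)
have [g ga] : exists g, ext g a.
  have [[XXX pre] _] := u_env.
  by have [g gP] := pre X (u \o (a : {linear M -> M})) XXX; exists g => x; rewrite gP.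
have [||||b [c [[b' bb'] [c' cc'] idem comp]]] :=
  @unit_subring_exchange _ [set g | exists f, ext g f] vnr self_inj lift _ _ _ g _.
- by move=> x y [f xf] [f' yf']; exists (f - f'); apply: extB.
- by move=> x y [f xf] [f' yf']; exists (f * f'); apply: extM.
- move=> x [y [xy yx]]; apply: (automorphism_restricts u_env M_inv).
  exists y => z; first exact: (congr1 (fun h : Endo X => h z) yx).
  exact: (congr1 (fun h : Endo X => h z) xy).
- by exists a.
(* Restrictions along the monomorphism [u] are unique, so both identities descend from X to M. *)
exists b', c'; split.
  by apply: extU (extM _ _ _ _ bb' ga); rewrite -idem; do 2!apply: (extM).
apply: extU (extB _ _ _ _ ext1 (extM _ _ _ _ bb' ga)) _.
by rewrite comp; apply: (extM) => //; apply: (extB).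
Qed.
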